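(* Let $N\geq 2$ be even and $M_2=N/2$. For any non-zero choice of $(b_1,b_2)\in\mathbb{Z}_N^2$ with $\gcd(b_1,b_2,M_2)=1$, the linear code $C$ over $\mathbb{Z}_N$ generated by the rows of $$\begin{pmatrix} M_2 & 0 & M_2 & b_1 & -b_1 \\ {} M_2 & M_2 & 0 & b_2 & -b_2 \end{pmatrix}$$ is either a direct sum or it is isomorphic to the code generated by the rows of $$g=\begin{pmatrix} M_2 & M_2 & 0 & 0 & 0 \\ {} M_2 & 0 & M_2 & 1 & N-1 \end{pmatrix}.$$ The simplex $\Delta_C$ corresponding to the latter code has $h^*(\Delta_C,t)=\left(\tfrac{3N}{2}-1\right)t^2+\tfrac N2t+1$.
   Context: $\mathbb{Z}_N=\mathbb{Z}/N\mathbb{Z}$, with elements identified with the representatives $0,\dots,N-1$. A linear code of length $n$ over $\mathbb{Z}_N$ is a submodule of $\mathbb{Z}_N^n$. Two codes over the same $\mathbb{Z}_N$ and of the same length are isomorphic if they coincide after a permutation of coordinates. Direct sum: for codes $C_1$ over $\mathbb{Z}_{N_1}$ and $C_2$ over $\mathbb{Z}_{N_2}$, of lengths $\ge1$, with $L=\operatorname{lcm}(N_1,N_2)$, $C_1\oplus C_2$ is the code over $\mathbb{Z}_L$ consisting of all concatenations $\frac{L}{N_1}c_1\,|\,\frac{L}{N_2}c_2$, $c_i\in C_i$. A code is a direct sum if it is isomorphic to some $C_1\oplus C_2$. Simplex of a code: for a code $C\subseteq\mathbb{Z}_N^{d+1}$ all of whose words have coordinate sum $0\bmod N$, let $M=\pi^{-1}(C)\subseteq\mathbb{Z}^{d+1}$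 with $\pi:\mathbb{Z}^{d+1}\to\mathbb{Z}_N^{d+1}$ the reduction map, and $\Delta_C=\operatorname{conv}(Ne_0,\dots,Ne_d)$, viewed as a $d$-dimensional lattice simplex with respect to the affine lattice $\operatorname{aff}(Ne_0,\dots,Ne_d)\cap M$. For a $d$-dimensional lattice polytope $\Delta$ with lattice $M'$, $h^*(\Delta,t)$ is defined by $1+\sum_{k\ge1}|k\Delta\cap M'|t^k=h^*(\Delta,t)/(1-t)^{d+1}$; for $\Delta_C$ one has $h^*(\Delta_C,t)=\sum_{c\in C}t^{\frac1N\sum_i c_i}$. *)

(* Defs.v *)
From HB Require Import structures.
From mathcomp Require Import all_boot all_order all_algebra all_fingroup.
From mathcomp Require Import all_classical all_reals.

Set Implicit Arguments.
Unset Strict Implicit.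
Unset Printing Implicit Defensive.

Import Order.TTheory GRing.Theory Num.Theory.

Local Open Scope ring_scope.

(* The ring of residues 0, ..., N-1 modulo N, for every N >= 1. The library's
   'Z_N is not used because 'Z_1 denotes Z/2, whereas direct sums of codes also
   range over the trivial ring Z/1; hence only a (possibly zero) ring. *)
Definition Zmod (N : nat) : Type := 'I_N.-1.+1.

HB.instance Definition _ N := Finite.on (Zmod N).
HB.instance Definition _ N := GRing.Zmodule.on (Zmod N).
HB.instance Definition _ N := GRing.Zmodule_isComPzRing.Build (Zmod N)
  (@Zp_mulA _) (@Zp_mulC _) (@Zp_mul1z _) (@Zp_mul_addl _).

Definition residue N (a : Zmod N) : nat := nat_of_ord a.

Definition is_code N n (C : {set 'rV[Zmod N]_n}) : Prop :=
  GRing.submod_closed (mem C).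

Definition code_gen N m n (G : 'M[Zmod N]_(m, n)) : {set 'rV[Zmod N]_n} :=
  [set u *m G | u : 'rV[Zmod N]_m]%SET.

Lemma code_gen_is_code N m n (G : 'M[Zmod N]_(m, n)) : is_code (code_gen G).
Proof.
split; first by apply/imsetP; exists 0; rewrite ?mul0mx.
move=> a _ _ /imsetP[u _ ->] /imsetP[v _ ->].
by apply/imsetP; exists (a *: u + v); rewrite // mulmxDl scalemxAl.
Qed.

Definition code_iso N n (C C' : {set 'rV[Zmod N]_n}) : Prop :=
  exists s : 'S_n, C' = [set col_perm s c | c in C]%SET.

(* c |-> (L / N) c, from words over Z/N to words over Z/L, where N %| L. *)
Definition rescale N L n (c : 'rV[Zmod N]_n) : 'rV[Zmod L]_n :=
  map_mx (fun a => (L %/ N * residue a)%:R) c.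

(* To be used with L = lcm(N1, N2); L is a separate argument so that the sum can
   be compared with a code over Z/N when N = lcm(N1, N2) propositionally. *)
Definition direct_sum L N1 N2 n1 n2
    (C1 : {set 'rV[Zmod N1]_n1}) (C2 : {set 'rV[Zmod N2]_n2}) :
    {set 'rV[Zmod L]_(n1 + n2)} :=
  [set row_mx (rescale L c1) (rescale L c2) | c1 in C1, c2 in C2]%SET.

Definition is_direct_sum N n (C : {set 'rV[Zmod N]_n}) : Prop :=
  exists (N1 N2 n1 n2 : nat) (en : (n1 + n2)%N = n)
         (C1 : {set 'rV[Zmod N1]_n1}) (C2 : {set 'rV[Zmod N2]_n2}),
    [/\ (0 < N1)%N /\ (0 < N2)%N,
        (0 < n1)%N /\ (0 < n2)%N,
        lcmn N1 N2 = N,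
        is_code C1 /\ is_code C2 &
        code_iso C [set castmx (erefl 1%N, en) c | c in direct_sum N C1 C2]%SET].

Definition mx_of_rows (R : pzRingType) m n (rows : seq (seq R)) : 'M[R]_(m, n) :=
  \matrix_(i, j) nth 0 (nth [::] rows i) j.

Section Ehrhart.
Local Open Scope classical_set_scope.
Local Open Scope card_scope.
Variable R : realType.

Definition conv n m (v : 'I_m -> 'rV[R]_n) : set 'rV[R]_n :=
  [set x | exists a : 'I_m -> R,
     [/\ forall i, 0 <= a i, \sum_i a i = 1 & x = \sum_i a i *: v i]].

Definition aff n m (v : 'I_m -> 'rV[R]_n) : set 'rV[R]_n :=
  [set x | exists a : 'I_m -> R, \sum_i a i = 1 /\ x = \sum_i a i *: v i].

(* The dilate k P relative to the origin o. For a lattice polytope P in an affine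
   lattice L, the number of points of L in it does not depend on o in L. *)
Definition dilate n (o : 'rV[R]_n) (k : nat) (P : set 'rV[R]_n) :
  set 'rV[R]_n := (fun x => o + k%:R *: (x - o)) @` P.

(* h = (1 - t)^(d+1) * (1 + sum_(k >= 1) |k P `&` L| t^k) as power series, with
   dilates taken relative to the point o of L. *)
Definition is_hstar n (d : nat) (L : set 'rV[R]_n) (o : 'rV[R]_n)
    (P : set 'rV[R]_n) (h : {poly int}) : Prop :=
  exists E : nat -> nat,
    [/\ E 0%N = 1%N,
        forall k : nat, (0 < k)%N -> (dilate o k P `&` L) #= `I_(E k) &
        forall m : nat,
          h`_m = \sum_(i < m.+1) ((1 - 'X) ^+ d.+1 : {poly int})`_i
                                 * (E (m - i)%N)%:R].

(* M = pi^-1(C), seen inside R^n. *)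
Definition code_lattice N n (C : {set 'rV[Zmod N]_n}) : set 'rV[R]_n :=
  [set map_mx intr z | z in
     [set z : 'rV[int]_n | map_mx (fun a : int => a%:~R : Zmod N) z \in C]].

Definition simplex_vertex (N d : nat) (i : 'I_d.+1) : 'rV[R]_d.+1 :=
  N%:R *: delta_mx 0 i.

Definition zero_sum N n (C : {set 'rV[Zmod N]_n}) : Prop :=
  forall c, c \in C -> \sum_i c 0 i = 0.

(* The simplex of C is only defined for zero-sum codes. *)
Definition simplex_hstar N d (C : {set 'rV[Zmod N]_d.+1}) (h : {poly int}) :
    Prop :=
  zero_sum C /\
  is_hstar d (aff (@simplex_vertex N d) `&` code_lattice C)
    (simplex_vertex N ord0) (conv (@simplex_vertex N d)) h.

End Ehrhart.

(* Main.v *)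
(* Write M = N/2, so that M a depends only on the parity of a. The words of C are
   (M (x + y), M y, M x, beta, - beta) with beta = x b1 + y b2. If b1 and b2 are
   both even, then M is odd, M kills b1 and b2 and fixes M, and C splits as the sum
   of its restrictions to the first three and to the last two coordinates.
   Otherwise gcd(b1, b2, N) = 1; taking p b1 + q b2 = 1, the base change with rows
   (- b2, b1) and (p, q) turns the generators into g up to one of six parity
   cases, each settled by a permutation of the first three coordinates.

   For h*, a lattice point of the k-th dilate is, after a translation, a
   nonnegative integer vector w of sum k N with w mod N in C. Euclidean division
   w = c + N t identifies these with pairs of a word c of weight ht(c) and a
   composition of k - ht(c), so that h* is the weight enumerator of C. *)
Require Import Defs.
From HB Require Import structures.
From mathcomp Require Import all_boot all_order all_algebra all_fingroup.
From mathcomp Require Import all_classical all_reals.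
From mathcomp Require Import ring.

Import Order.TTheory GRing.Theory Num.Theory.

Local Open Scope ring_scope.

Lemma residue_nat {N : nat} n : (0 < N)%N -> residue (n%:R : Zmod N) = (n %% N)%N.
Proof.
move=> N0.
have -> : (n%:R : Zmod N) = inZp n.
  elim: n => [|n IHn]; apply: val_inj => //=.
  by rewrite mulrSr IHn /= modnDm addn1.
by rewrite /residue /= prednK.
Qed.

Lemma residueK {N : nat} (a : Zmod N) : (residue a)%:R = a.
Proof.
apply/val_inj; have := @residue_nat N.-1.+1 (residue a) isT.
by rewrite /residue /= => ->; rewrite modn_small // ltn_ord.
Qed.

Lemma residue_lt {N : nat} (a : Zmod N) : (0 < N)%N -> (residue a < N)%N.
Proof. by move=> N0; rewrite -[ltnRHS](prednK N0) ltn_ord. Qed.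

Lemma Zmod_natN {N : nat} : (0 < N)%N -> N%:R = 0 :> Zmod N.
Proof. by move=> N0; rewrite -[LHS]residueK residue_nat // modnn. Qed.

Lemma residue_inj {N : nat} : injective (@residue N).
Proof. exact: val_inj. Qed.

Lemma residue_opp {N : nat} (a : Zmod N) : (0 < N)%N ->
  residue (- a) = if a == 0 then 0%N else (N - residue a)%N.
Proof.
move=> N0; have [->|a0] := eqVneq; first by rewrite oppr0.
have r0 : (0 < residue a)%N.
  rewrite lt0n; apply: contra a0 => /eqP r0; by rewrite -(residueK a) r0.
have -> : - a = (N - residue a)%:R.
  by rewrite natrB ?(ltnW (residue_lt a N0)) // residueK Zmod_natN // sub0r.
by rewrite residue_nat // modn_small // ltn_subrL r0.
Qed.

Lemma coef_1subX_bin d m :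
  (((1 - 'X) ^+ d.+1 : {poly int}) * \poly_(j < m.+1) 'C(j + d, d)%:R)`_m
  = (m == 0%N)%:R.
Proof.
suff H : forall d j n, (j <= n)%N ->
   (((1 - 'X) ^+ d.+1 : {poly int}) * \poly_(j < n.+1) 'C(j + d, d)%:R)`_j
   = (j == 0%N)%:R by exact: H.
clear d m; elim=> [|d IH] j n jn.
  rewrite expr1 mulrBl mul1r coefB coefXM !coef_poly ltnS jn bin0.
  case: j jn => [|j] jn; first by rewrite subr0.
  by rewrite /= bin0 ltnS ltnW // subrr.
rewrite exprSr -mulrA.
have key i : (i <= n)%N -> ((1 - 'X) * \poly_(j < n.+1) 'C(j + d.+1, d.+1)%:R)`_i =
   (\poly_(j < n.+1) 'C(j + d, d)%:R : {poly int})`_i.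
  move=> iN; rewrite mulrBl mul1r coefB coefXM !coef_poly ltnS iN.
  case: i iN => [|i] iN /=; first by rewrite !add0n !binn subr0.
  by rewrite ltnS ltnW // addnS binS natrD addSn addnS addrAC subrr add0r.
rewrite -(IH j n jn) !coefM; apply: eq_bigr => i _; rewrite key //.
exact: leq_trans (leq_subr _ _) jn.
Qed.

Lemma coef_1subX_conv (d : nat) (h : {poly int}) (E : nat -> nat) :
  (forall k, (E k)%:R = \sum_(i < k.+1) h`_i * 'C(k - i + d, d)%:R) ->
  forall m, h`_m = \sum_(i < m.+1) ((1 - 'X) ^+ d.+1 : {poly int})`_i * (E (m - i)%N)%:R.
Proof.
move=> EE m.
pose B : {poly int} := \poly_(j < m.+1) 'C(j + d, d)%:R.
have HB j : (j <= m)%N -> ((1 - 'X) ^+ d.+1 * B)`_j = (j == 0%N)%:R.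
  move=> jm; rewrite -(coef_1subX_bin d) !coefM.
  apply: eq_bigr => i _; congr (_ * _); rewrite !coef_poly.
  by rewrite !ltnS leq_subr (leq_trans (leq_subr _ _)).
transitivity (((1 - 'X) ^+ d.+1 * (h * B))`_m).
  rewrite mulrCA coefM big_ord_recr /= subnn HB // mulr1 big1 ?add0r // => i _.
  by rewrite HB ?leq_subr // subn_eq0 leqNgt ltn_ord mulr0.
rewrite coefM; apply: eq_bigr => i _; rewrite EE coefM; congr (_ * _).
apply: eq_bigr => j _; rewrite coef_poly ltnS.
by rewrite (leq_trans (leq_subr _ _)) // leq_subr.
Qed.

Lemma card_ord_partitions_le m K n : (n <= K)%N ->
  #|[set t : m.+1.-tuple 'I_K.+1 | \sum_(i <- t) (i : nat) == n]%SET|%N = 'C(m + n, m).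
Proof.
move=> nK; rewrite -card_ord_partitions.
have nK1 : (n.+1 <= K.+1)%N by [].
pose f (t : m.+1.-tuple 'I_n.+1) := map_tuple (widen_ord nK1) t.
have f_inj : injective f.
  move=> s t /(congr1 val) /= st; apply/val_inj/(inj_map _ st) => x y /(congr1 val) xy.
  exact/val_inj.
rewrite -(card_imset _ f_inj); apply: eq_card => t.
rewrite inE; apply/idP/imsetP => [tn|[s]]; last first.
  by rewrite inE => sn ->; rewrite big_map.
have t_le x : x \in t -> (x <= n)%N.
  by move=> xt; rewrite -(eqP tn) (big_rem x) //= leq_addr.
exists (map_tuple (fun x : 'I_K.+1 => inord x) t).
  rewrite inE big_map; apply/eqP; rewrite -[RHS](eqP tn) !big_seq.
  by apply: eq_bigr => x xt; rewrite inordK // ltnS t_le.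
apply/val_inj; rewrite /= -map_comp -[LHS]map_id; apply/eq_in_map => x xt.
by apply/val_inj; rewrite /= inordK // ltnS t_le.
Qed.

(* The division is exact for words of zero-sum codes. *)
Definition weight {N n : nat} (c : 'rV[Zmod N]_n) : nat :=
  ((\sum_i residue (c ord0 i)) %/ N)%N.

Lemma weightM {N n : nat} (C : {set 'rV[Zmod N]_n}) c : (0 < N)%N ->
  zero_sum C -> c \in C -> (\sum_i residue (c ord0 i) = weight c * N)%N.
Proof.
move=> N0 C0 /C0 c0; rewrite /weight divnK // /dvdn -residue_nat // natr_sum.
by under eq_bigr do rewrite residueK; rewrite c0.
Qed.

Definition lattice_count {N d : nat} (C : {set 'rV[Zmod N]_d.+1}) k : nat :=
  (\sum_(c in C) if weight c <= k then 'C(k - weight c + d, d) else 0)%N.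

Lemma lattice_countE {N d : nat} (C : {set 'rV[Zmod N]_d.+1}) k :
  (lattice_count C k)%:R =
  \sum_(i < k.+1) (\sum_(c in C) 'X^(weight c) : {poly int})`_i * 'C(k - i + d, d)%:R.
Proof.
under eq_bigr do rewrite coef_sum mulr_suml.
rewrite exchange_big natr_sum; apply: eq_bigr => c _.
under eq_bigr do rewrite coefXn.
case: leqP => [ck|kc].
  rewrite (bigD1 (Ordinal (ck : (weight c < k.+1)%N))) //= eqxx mul1r.
  by rewrite big1 ?addr0 // => i /negPf; rewrite -val_eqE /= => ->; rewrite mul0r.
rewrite big1 // => i _; case: eqP => [iw|_]; last by rewrite mul0r.
by have := ltn_ord i; rewrite iw ltnS leqNgt kc.
Qed.

Definition codeword_shifts {N d : nat} (C : {set 'rV[Zmod N]_d.+1}) (k : nat) :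
  {set 'rV[Zmod N]_d.+1 * d.+1.-tuple 'I_k.+1} :=
  [set p : 'rV[Zmod N]_d.+1 * d.+1.-tuple 'I_k.+1 |
    (p.1 \in C) && (weight p.1 + \sum_(i <- p.2) (i : nat) == k)%N]%SET.

Lemma card_codeword_shifts {N d : nat} (C : {set 'rV[Zmod N]_d.+1}) k :
  #|codeword_shifts C k| = lattice_count C k.
Proof.
rewrite -sum1_card.
under eq_bigl do rewrite inE.
rewrite -(pair_big_dep (fun c => c \in C) (fun c (t : d.+1.-tuple 'I_k.+1) =>
  weight c + \sum_(i <- t) (i : nat) == k)%N (fun _ _ => 1%N)) /=.
apply: eq_bigr => c _; rewrite sum1_card.
case: leqP => [ck|kc].
  rewrite addnC -(card_ord_partitions_le _ k) ?leq_subr //; apply: eq_card => t.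
  by rewrite inE unfold_in /= -(eqn_add2l (weight c)) subnKC.
apply: eq_card0 => t; apply/negP => /eqP e; have := kc.
by rewrite -[X in (X < _)%N]e ltnNge leq_addr.
Qed.

Section Points.
Local Open Scope classical_set_scope.
Local Open Scope card_scope.
Context {R : realType}.

Lemma simplex_combE {N d : nat} (a : 'I_d.+1 -> R) (j : 'I_d.+1) :
  (\sum_i a i *: @simplex_vertex R N d i) ord0 j = a j * N%:R.
Proof.
rewrite summxE (bigD1 j) //= big1 ?addr0 => [|i ij].
  by rewrite !mxE !eqxx mulr1.
by rewrite !mxE eqxx /= eq_sym (negPf ij) !mulr0.
Qed.

(* Dilating by k about N e_0 is dilating by k about 0 and subtracting (k - 1) N e_0. *)
Definition shifted_point {N d : nat} (k : nat)
    (p : 'rV[Zmod N]_d.+1 * d.+1.-tuple 'I_k.+1) : 'rV[R]_d.+1 :=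
  \row_i (residue (p.1 ord0 i) + N * tnth p.2 i)%N%:R
  - (k%:R - 1) *: @simplex_vertex R N d ord0.

Lemma shifted_point_inj {N d : nat} k : (0 < N)%N -> injective (@shifted_point N d k).
Proof.
move=> N0 [c t] [c' t'] /addIr /rowP e.
have {}e i : residue (c ord0 i) = residue (c' ord0 i) /\ tnth t i = tnth t' i.
  have /eqP := e i; rewrite !mxE /= eqr_nat => /eqP ei.
  split.
    have := congr1 (modn^~ N) ei.
    by rewrite ![(N * _)%N]mulnC ![(residue _ + _)%N]addnC !modnMDl !modn_small ?residue_lt.
  apply: val_inj; have := congr1 (divn^~ N) ei.
  by rewrite ![(N * _)%N]mulnC ![(residue _ + _)%N]addnC !divnMDl // !divn_small ?residue_lt ?addn0.
congr pair.
  by apply/rowP => i; apply: residue_inj; case: (e i).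
by apply: eq_from_tnth => i; case: (e i).
Qed.

Lemma shifted_point_image {N d : nat} (C : {set 'rV[Zmod N]_d.+1}) k : (0 < N)%N ->
  (0 < k)%N -> zero_sum C ->
  @shifted_point N d k @` [set` codeword_shifts C k] =
  dilate (@simplex_vertex R N d ord0) k (conv (@simplex_vertex R N d)) `&`
  (aff (@simplex_vertex R N d) `&` code_lattice C).
Proof.
move=> N0 k0 C0.
have NR : N%:R != 0 :> R by rewrite pnatr_eq0 -lt0n.
have kR : k%:R != 0 :> R by rewrite pnatr_eq0 -lt0n.
set o := @simplex_vertex R N d ord0.
have dil (x : 'rV[R]_d.+1) : o + k%:R *: (x - o) = k%:R *: x - (k%:R - 1) *: o.
  by rewrite scalerBr scalerBl scale1r opprB addrCA.
have oE j : o ord0 j = N%:R * (j == ord0)%:R.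
  by rewrite !mxE eqxx.
apply/seteqP; split => [_ [[c t] /= + <-]|y].
  rewrite inE /= big_tuple => /andP[cC /eqP wk].
  have sumw : (\sum_i (residue (c ord0 i) + N * tnth t i) = k * N)%N.
    by rewrite big_split /= (weightM C c N0 C0 cC) -big_distrr /= [(N * _)%N]mulnC -mulnDl wk.
  have sumwR : \sum_i (residue (c ord0 i) + N * tnth t i)%N%:R = k%:R * N%:R :> R.
    by rewrite -natr_sum sumw natrM.
  split; last split.
  - exists (k%:R^-1 *: \row_i (residue (c ord0 i) + N * tnth t i)%N%:R); last first.
      by rewrite dil scalerA mulfV // scale1r.
    exists (fun i => (k%:R * N%:R)^-1 * (residue (c ord0 i) + N * tnth t i)%N%:R); split.
    + by move=> i; rewrite mulr_ge0 // invr_ge0 mulr_ge0.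
    + by rewrite -mulr_sumr sumwR mulVf // mulf_neq0.
    + apply/rowP => j; rewrite simplex_combE !mxE.
      by field; rewrite NR kR.
  - exists (fun i => N%:R^-1 * shifted_point k (c, t) ord0 i); split; last first.
      by apply/rowP => j; rewrite simplex_combE mulrAC mulVf // mul1r.
    rewrite -mulr_sumr.
    under eq_bigr do rewrite !mxE.
    rewrite sumrB sumwR (bigD1 ord0) //= big1 => [|i /negPf i0]; last first.
      by rewrite i0 !mulr0.
    by field.
  - exists (\row_i ((residue (c ord0 i) + N * tnth t i)%N%:R
        - (k%:R - 1) * (N%:R * (i == ord0)%:R))).
      rewrite /=; set z := \row_i _.
      suff -> : map_mx (fun a : int => a%:~R : Zmod N) z = c by [].
      apply/rowP => i; rewrite !mxE.
      rewrite rmorphB !rmorphM /= !rmorph_nat natrD residueK natrM Zmod_natN //.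
      by rewrite !mul0r mulr0 subr0 addr0.
    apply/rowP => i; rewrite /shifted_point mxE [in RHS]mxE.
    rewrite [in RHS]mxE !mxE eqxx /=.
    by rewrite rmorphB !rmorphM rmorphB /= !rmorph_nat rmorph1.
case=> -[x [a [a0 a1 xE]] yE] [_ [z zC zE]].
have w_int i : exists w : nat, z ord0 i + (k%:R - 1) * (N%:R * (i == ord0)%:R) = w%:R
     /\ w%:R = k%:R * (a i * N%:R) :> R.
  have e : (z ord0 i + (k%:R - 1) * (N%:R * (i == ord0)%:R))%:~R = k%:R * (a i * N%:R) :> R.
    have : y ord0 i = (z ord0 i)%:~R by rewrite -zE mxE.
    rewrite -yE /= dil [in LHS]mxE [X in X + _]mxE xE simplex_combE [X in _ + X]mxE.
    rewrite [X in - X]mxE oE => e.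
    rewrite rmorphD !rmorphM rmorphB /= !rmorph_nat -e.
    by rewrite subrK.
  have : 0 <= (z ord0 i + (k%:R - 1) * (N%:R * (i == ord0)%:R))%:~R :> R.
    by rewrite e !mulr_ge0.
  rewrite ler0z; move: e.
  by case: (z ord0 i + _) => // w e _; exists w; split; rewrite ?natz.
have [w wE] := choice w_int.
have sumw : (\sum_i w i = k * N)%N.
  apply/eqP; rewrite -(eqr_nat R) natr_sum natrM.
  under eq_bigr do rewrite (wE _).2.
  by rewrite -mulr_sumr -mulr_suml a1 mul1r.
have w_le i : (w i %/ N <= k)%N.
  by rewrite -(mulnK k N0) leq_div2r // -sumw (bigD1 i) //= leq_addr.
pose c : 'rV[Zmod N]_d.+1 := \row_i (w i)%:R.
have cE : map_mx (fun b : int => b%:~R) z = c.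
  apply/rowP => i; rewrite !mxE.
  have := congr1 (fun b : int => b%:~R : Zmod N) (wE i).1.
  by rewrite /= rmorphD !rmorphM !rmorph_nat Zmod_natN // mul0r mulr0 addr0.
have cC : c \in C by rewrite -cE.
have wdiv i : (residue ((w i)%:R : Zmod N) + N * (w i %/ N) = w i)%N.
  by rewrite residue_nat // addnC mulnC -divn_eq.
exists (c, [tuple inord (w i %/ N) | i < d.+1]).
  rewrite /= inE /= cC /=.
  rewrite -(eqn_pmul2r N0) mulnDl -(weightM C c N0 C0 cC) // -sumw big_map big_enum /=.
  rewrite big_distrl -big_split /=; apply/eqP; apply: eq_bigr => i _.
  by rewrite inordK ?ltnS // mulnC mxE wdiv.
rewrite -yE dil /shifted_point; congr (_ - _); apply/rowP => i.
by rewrite !mxE xE simplex_combE tnth_mktuple inordK ?ltnS //= wdiv (wE i).2.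
Qed.

Lemma card_finset_II (T : finType) (A : {set T}) : [set` A] #= `I_#|A|.
Proof.
have -> : [set` A] = @enum_val T (mem A) @` [set: 'I_#|A|].
  apply/seteqP; split => [x /= xA|_ /= [i _ <-]]; last exact: enum_valP.
  by exists (enum_rank_in xA x); rewrite ?enum_rankK_in.
apply: card_eq_trans (inj_card_eq _) _; first by move=> i j _ _; exact: enum_val_inj.
by rewrite card_eq_sym card_II.
Qed.

Lemma simplex_hstar_weight {N d : nat} (C : {set 'rV[Zmod N]_d.+1}) : (0 < N)%N ->
  is_code C -> zero_sum C -> simplex_hstar R C (\sum_(c in C) 'X^(weight c)).
Proof.
move=> N0 [zC _] C0; split => //; exists (lattice_count C); split.
- rewrite /lattice_count (bigD1 0) //= big1 => [|c /andP[cC c0]].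
    rewrite /weight big1 ?div0n ?leqnn ?binn // => i _.
    by rewrite mxE -(mulr0n 1) residue_nat // mod0n.
  case: leqP => //; rewrite leqn0 => /eqP wc.
  have := weightM C c N0 C0 cC; rewrite wc mul0n => /eqP.
  rewrite sum_nat_eq0 => /forallP rc; case/eqP: c0.
  by apply/rowP => i; rewrite mxE -(residueK (c ord0 i)) (eqP (rc i)).
- move=> k k0; rewrite -(shifted_point_image _ _ N0 k0 C0).
  apply: card_eq_trans (inj_card_eq _) _.
    by move=> p q _ _; exact: shifted_point_inj.
  rewrite -card_codeword_shifts; exact: card_finset_II.
- apply: coef_1subX_conv; exact: lattice_countE.
Qed.
End Points.

Lemma bezout_Zmod {N : nat} (m n : nat) :
  exists p q : Zmod N, p * m%:R + q * n%:R = (gcdn m n)%:R.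
Proof.
case: (posnP m) => [->|m0]; first by exists 0, 1; rewrite gcd0n mul0r mul1r add0r.
case: (egcdnP n m0) => km kn e _; exists km%:R, (- kn%:R).
by rewrite -natrM e natrD natrM mulNr addrC addrA addNr add0r.
Qed.

Lemma code_gen_mulmx {N k m n : nat} (U : 'M[Zmod N]_(k, m)) (V : 'M_(m, k)) (G : 'M_(m, n)) :
  V *m U = 1%:M -> code_gen (U *m G) = code_gen G.
Proof.
move=> VU; apply/setP => c; apply/imsetP/imsetP => -[u _ ->].
  by exists (u *m U); rewrite ?mulmxA.
by exists (u *m V); rewrite // -[RHS]mulmxA (mulmxA V) VU mul1mx.
Qed.

Lemma code_iso_col_perm {N m n : nat} (s : 'S_n) (G : 'M[Zmod N]_(m, n)) :
  code_iso (code_gen G) (code_gen (col_perm s G)).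
Proof.
exists s; apply/setP => c; apply/imsetP/imsetP => [[u _ ->]|[_ /imsetP[u _ ->] ->]].
  exists (u *m G); first exact: imset_f.
  by rewrite !col_permE mulmxA.
by exists u => //; rewrite !col_permE mulmxA.
Qed.

Section EvenModulus.
Context {N : nat} (N0 : (0 < N)%N) (Neven : ~~ odd N).
Let M : Zmod N := (N %/ 2)%N%:R.

Lemma half_even : N = (N %/ 2 * 2)%N.
Proof. by rewrite divnK // dvdn2. Qed.

Lemma residue_half : residue M = (N %/ 2)%N.
Proof. by rewrite residue_nat // modn_small // ltn_Pdiv. Qed.

Lemma half_neq0 : M != 0.
Proof.
apply/eqP => M0; have := residue_half; rewrite M0 -(mulr0n 1) residue_nat // mod0n => e.
by move: N0; rewrite half_even -e.
Qed.

Lemma half_addK : M + M = 0.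
Proof. by rewrite -natrD addnn -muln2 -half_even Zmod_natN. Qed.

Lemma half_opp : - M = M.
Proof. by apply/eqP; rewrite eq_sym -addr_eq0 half_addK. Qed.

Lemma half_mul a : M * a = M *+ odd (residue a).
Proof.
rewrite -{1}(residueK a) mulr_natr -{1}(odd_double_half (residue a)) mulrnDr.
by rewrite -mul2n mulrnA mulr2n half_addK mul0rn addr0.
Qed.

Lemma even_direct_sum (b1 b2 : Zmod N) : odd (N %/ 2) ->
  ~~ odd (residue b1) -> ~~ odd (residue b2) ->
  is_direct_sum (code_gen (mx_of_rows 2 5 [:: [:: M; 0; M; b1; - b1]; [:: M; M; 0; b2; - b2]])).
Proof.
move=> M2odd b1e b2e; set G := mx_of_rows _ _ _.
pose G1 : 'M[Zmod N]_(2, 3) := mx_of_rows 2 3 [:: [:: M; 0; M]; [:: M; M; 0]].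
pose G2 : 'M[Zmod N]_(2, 2) := mx_of_rows 2 2 [:: [:: b1; - b1]; [:: b2; - b2]].
have GE : G = row_mx G1 G2 :> 'M_(2, 3 + 2).
  apply/matrixP => i j; rewrite !mxE; case: splitP => k kE; rewrite mxE kE;
  by case: i => [[|[|//]] ?]; case: k kE => [[|[|[|//]]] ?].
have mulG (u : 'rV_2) : u *m G = row_mx (u *m G1) (u *m G2).
  by rewrite GE; exact: (@mul_mx_row _ 1 2 3 2 u G1 G2).
have MM : M * M = M by rewrite half_mul residue_half M2odd.
have Mb1 : M * b1 = 0 by rewrite half_mul (negbTE b1e).
have Mb2 : M * b2 = 0 by rewrite half_mul (negbTE b2e).
have MG1 : M *: G1 = G1.
  apply/matrixP => i j; rewrite !mxE; case: i => [[|[|//]] ?]; case: j => [[|[|[|//]]] ?] /=;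
  by rewrite ?MM ?mulr0.
have MG2 : M *: G2 = 0.
  apply/matrixP => i j; rewrite !mxE; case: i => [[|[|//]] ?]; case: j => [[|[|//]] ?] /=;
  by rewrite ?mulrN ?Mb1 ?Mb2 ?oppr0.
have MG1' : (M + 1) *: G1 = 0.
  by rewrite scalerDl scale1r -{2}MG1 -scalerDl half_addK scale0r.
have MG2' : (M + 1) *: G2 = G2 by rewrite scalerDl scale1r MG2 add0r.
have resc n (c : 'rV[Zmod N]_n) : rescale N c = c.
  by apply/rowP => i; rewrite mxE divnn N0 mul1n residueK.
exists N, N, 3, 2, erefl, (code_gen G1), (code_gen G2); split => //.
- by rewrite /lcmn gcdnn mulnK.
- by split; apply: code_gen_is_code.
exists 1%g; apply/setP => c; apply/imsetP/imsetP => -[].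
  move=> _ /imset2P[_ _ /imsetP[u1 _ ->] /imsetP[u2 _ ->] ->] ->.
  rewrite castmx_id !resc; exists (row_mx (u1 *m G1) (u2 *m G2) : 'rV_5); last by rewrite col_perm1.
  (* M fixes G1 and kills G2, while M + 1 does the opposite. *)
  apply/imsetP; exists (M *: u1 + (M + 1) *: u2) => //.
  rewrite mulG !mulmxDl -!scalemxAl !scalemxAr MG1 MG2.
  by rewrite MG1' MG2' !mulmx0 addr0 add0r.
move=> _ /imsetP[u _ ->] ->; rewrite col_perm1.
exists (u *m G); last by rewrite castmx_id.
by apply/imset2P; exists (u *m G1) (u *m G2); rewrite ?resc ?mulG //; apply: imset_f.
Qed.

Lemma natrB1_Zmod : (N - 1)%N%:R = - 1 :> Zmod N.
Proof. by rewrite natrB // Zmod_natN // sub0r. Qed.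

Let g : 'M[Zmod N]_(2, 5) := mx_of_rows 2 5
    [:: [:: M; M; 0; 0; 0]; [:: M; 0; M; 1; (N - 1)%N%:R]].

Lemma odd_code_iso (b1 b2 p q : Zmod N) :
  odd (residue b1) || odd (residue b2) ->
  p * b1 + q * b2 = 1 ->
  code_iso (code_gen (mx_of_rows 2 5 [:: [:: M; 0; M; b1; - b1]; [:: M; M; 0; b2; - b2]]))
    (code_gen g).
Proof.
move=> bodd pq; set G := mx_of_rows _ _ _.
pose U : 'M[Zmod N]_2 := mx_of_rows 2 2 [:: [:: - b2; b1]; [:: p; q]].
pose V : 'M[Zmod N]_2 := mx_of_rows 2 2 [:: [:: - q; b1]; [:: p; b2]].
have VU : V *m U = 1%:M.
  apply/matrixP => i j; rewrite !mxE !big_ord_recl big_ord0 !mxE.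
  case: i => [[|[|//]] ?]; case: j => [[|[|//]] ?] /=; rewrite addr0.
  - by rewrite mulrNN addrC [b1 * p]mulrC.
  - by rewrite mulNr [q * b1]mulrC addNr.
  - by rewrite mulrN [p * b2]mulrC addNr.
  - by rewrite [b2 * q]mulrC.
rewrite -(code_gen_mulmx U V G VU).
have UG : U *m G = mx_of_rows 2 5 [:: [:: M * b1 + M * b2; M * b1; M * b2; 0; 0];
   [:: M * p + M * q; M * q; M * p; 1; (N - 1)%N%:R]].
  have Mb : b2 * M = - (M * b2) by rewrite -mulNr half_opp mulrC.
  apply/matrixP => i j; rewrite !mxE !big_ord_recl big_ord0 !mxE.
  case: i => [[|[|//]] ?]; case: j => [[|[|[|[|[|//]]]]] ?] /=; rewrite addr0 ?mulr0 ?add0r ?addr0 //.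
  all: rewrite ?natrB1_Zmod ?mulNr ?mulrN ?Mb ?opprK //.
  - by rewrite addrC [b1 * _]mulrC.
  - by rewrite [b1 * _]mulrC.
  - by rewrite [b1 * _]mulrC addNr.
  - by rewrite [b1 * _]mulrC subrr.
  - by rewrite ![_ * M]mulrC.
  - by rewrite ![_ * M]mulrC.
  - by rewrite ![_ * M]mulrC.
  - by rewrite -opprD pq.
have Mpq : p * (M * b1) + q * (M * b2) = M.
  by rewrite ![_ * (M * _)]mulrCA -mulrDr pq mulr1.
suff [s <-] : exists s : 'S_5, col_perm s (U *m G) = g by exact: code_iso_col_perm.
pose o0 : 'I_5 := ord0; pose o1 : 'I_5 := Ordinal (isT : (1 < 5)%N).
pose o2 : 'I_5 := Ordinal (isT : (2 < 5)%N).
have M0 := negP half_neq0.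
rewrite UG; move: Mpq bodd; rewrite !half_mul ![_ * (M *+ _)]mulrnAr ![_ * M]mulrC !half_mul.
case: (odd (residue b1)); case: (odd (residue b2)) => //;
 case: (odd (residue p)); case: (odd (residue q));
 rewrite ?mulr1n ?mulr0n ?addr0 ?add0r ?half_addK => e _;
 try by case: M0; rewrite -e.
all: [> exists (tperm o0 o2) | exists (tperm o0 o2 * tperm o1 o2)%g
  | exists (tperm o0 o1) | exists 1%g
  | exists (tperm o0 o1 * tperm o1 o2)%g | exists (tperm o1 o2)].
all: apply/matrixP => i j; rewrite !mxE; case: i => [[|[|//]] ?];
  by case: j => [[|[|[|[|[|//]]]]] ?]; rewrite ?permM !permE.
Qed.

Lemma residue_bezout (b1 b2 : Zmod N) :
  odd (residue b1) || odd (residue b2) ->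
  gcdn (gcdn (residue b1) (residue b2)) (N %/ 2) = 1%N ->
  exists p q : Zmod N, p * b1 + q * b2 = 1.
Proof.
set d := gcdn (residue b1) _ => bodd dM.
have d_odd : odd d.
  case/orP: bodd; apply: contraTT; rewrite -!dvdn2 => /dvdn_trans; apply.
    exact: dvdn_gcdl.
  exact: dvdn_gcdr.
have dN : gcdn d N = 1%N.
  have : coprime d (N %/ 2 * 2) by rewrite coprimeMr coprimen2 d_odd andbT /coprime dM.
  by rewrite -half_even => /eqP.
have [p [q]] := @bezout_Zmod N (residue b1) (residue b2); rewrite !residueK => pq.
have [r [t]] := @bezout_Zmod N d N.
rewrite dN Zmod_natN // mulr0 addr0 -pq mulrDr !mulrA => e.
by exists (r * p), (r * q).
Qed.

Definition codeword (p : bool * Zmod N) : 'rV[Zmod N]_5 :=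
  \row_j nth 0 [:: M *+ p.1 + M *+ odd (residue p.2); M *+ p.1; M *+ odd (residue p.2);
    p.2; - p.2] j.

Lemma code_gen_codeword : code_gen g = [set codeword p | p : bool * Zmod N]%SET.
Proof.
have uE (u : 'rV_2) : u *m g = codeword (odd (residue (u ord0 ord0)), u ord0 (lift ord0 ord0)).
  apply/rowP => j; rewrite !mxE !big_ord_recl big_ord0 !mxE addr0 /= natrB1_Zmod.
  rewrite -!half_mul; case: j => [[|[|[|[|[|//]]]]] ?] /=;
  by rewrite ?mulr0 ?addr0 ?add0r ?mulr1 ?mulrN1 // ![_ * M]mulrC.
apply/setP => c; apply/imsetP/imsetP => -[].
  by move=> u _ ->; rewrite uE; eexists; last reflexivity.
move=> [b y] _ ->; exists (\row_j (if j == ord0 then if b then 1 else 0 else y)) => //.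
rewrite uE !mxE /=; congr codeword; congr pair.
have N1 : (1 < N)%N by case: N N0 Neven => [|[|]].
by case: b => //; rewrite -(mulr1n 1) residue_nat // modn_small.
Qed.

Lemma codeword_inj : injective codeword.
Proof.
move=> [b y] [b' y'] /rowP e.
have := e (Ordinal (isT : (3 < 5)%N)); rewrite !mxE /= => ->.
have := e (Ordinal (isT : (1 < 5)%N)); rewrite !mxE /=.
by case: b b' {e} => -[] //= /eqP; rewrite ?[_ == M]eq_sym (negbTE half_neq0).
Qed.

Lemma weight_codeword p :
  weight (codeword p) = ((p.1 || odd (residue p.2)) + (0 < residue p.2))%N.
Proof.
have r0 : residue (0 : Zmod N) = 0%N by rewrite -(mulr0n 1) residue_nat // mod0n.
have rM (b : bool) : residue (M *+ b) = (N %/ 2 * b)%N.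
  by case: b; [rewrite mulr1n residue_half muln1 | rewrite mulr0n r0 muln0].
have rMM (b b' : bool) : residue (M *+ b + M *+ b') = (N %/ 2 * (b (+) b'))%N.
  by rewrite -rM; case: b; case: b'; rewrite ?mulr1n ?mulr0n ?half_addK ?addr0 ?add0r.
have ry : (residue p.2 + residue (- p.2) = N * (0 < residue p.2))%N.
  rewrite residue_opp //; have [->|y0] := eqVneq; first by rewrite r0 muln0.
  have -> : (0 < residue p.2)%N.
    by rewrite lt0n; apply: contra y0 => /eqP r; apply/eqP; rewrite -(residueK p.2) r.
  by rewrite subnKC ?muln1 // ltnW // residue_lt.
have wE : (\sum_i residue (codeword p ord0 i) =
    residue (M *+ p.1 + M *+ odd (residue p.2))%R + residue (M *+ p.1)%R +
    residue (M *+ odd (residue p.2))%R + (residue p.2 + residue (- p.2)%R))%N.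
  by rewrite !big_ord_recl big_ord0 !mxE addn0 !addnA.
rewrite /weight wE rMM !rM ry -!mulnDr.
rewrite [X in (N %/ 2 * X)%N](_ : _ = (2 * (p.1 || odd (residue p.2)))%N); last first.
  by case: p.1; case: odd.
by rewrite mulnA -half_even -mulnDr mulKn.
Qed.

Lemma zero_sum_codeword p : \sum_i codeword p ord0 i = 0.
Proof.
rewrite !big_ord_recl big_ord0 !mxE /= addr0 subrr addr0.
by rewrite addrACA -!(mulrnDl _ M M) half_addK !mul0rn addr0.
Qed.

Lemma sum_weight_codeword :
  \sum_p 'X^(weight (codeword p)) =
    ((3 * N %/ 2)%N%:R - 1) *: 'X^2 + (N %/ 2)%N%:R *: 'X + 1 :> {poly int}.
Proof.
rewrite -(pair_bigA _ (fun b y => 'X^(weight (codeword (b, y))))) /= big_bool /=.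
rewrite -big_split /=.
under eq_bigr do rewrite !weight_codeword /= add1n.
pose F y : {poly int} := 'X^((0 < y)%N.+1) + 'X^(odd y + (0 < y)%N).
transitivity (\sum_(0 <= y < N) F y).
  by rewrite -(prednK N0) big_mkord.
have [k kE] : exists k, (N %/ 2 = k.+1)%N.
  by exists (N %/ 2).-1; rewrite prednK // divn_gt0 //; case: N N0 Neven => [|[|]].
have -> : (3 * N %/ 2 = 3 * k.+1)%N by rewrite -kE {1}half_even mulnA mulnK.
rewrite {1}half_even kE.
elim: k {kE} => [|k IH].
  rewrite !big_nat_recr //= big_nil /F /= muln1 scale1r scalerBl scaler_nat scale1r expr0.
  by ring.
rewrite (_ : k.+2 * 2 = (k.+1 * 2).+2)%N; last by rewrite mulSn.
rewrite big_nat_recr // big_nat_recr // IH /F oddM andbF /= oddM andbF.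
rewrite !scalerBl !scaler_nat !scale1r.
by ring.
Qed.

Lemma simplex_hstar_gen (R : realType) : simplex_hstar R (code_gen g)
    (((3 * N %/ 2)%N%:R - 1) *: 'X^2 + (N %/ 2)%N%:R *: 'X + 1).
Proof.
rewrite -sum_weight_codeword.
have -> : \sum_p 'X^(weight (codeword p)) = \sum_(c in code_gen g) 'X^(weight c) :> {poly int}.
  rewrite code_gen_codeword big_imset /=; first by apply: eq_bigl => p; rewrite inE.
  by move=> p q _ _; exact: codeword_inj.
apply: simplex_hstar_weight => //; first exact: code_gen_is_code.
by move=> c; rewrite code_gen_codeword => /imsetP[p _ ->]; exact: zero_sum_codeword.
Qed.

End EvenModulus.

Theorem lemma3p9 (R : realType) (N : nat) (hN : (2 <= N)%N) (hNeven : ~~ odd N) :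
  let M2 : nat := (N %/ 2)%N in
  let M : Zmod N := M2%:R in
  let g : 'M[Zmod N]_(2, 5) := mx_of_rows 2 5
    [:: [:: M; M; 0; 0; 0];
        [:: M; 0; M; 1; (N - 1)%N%:R]] in
  (forall b1 b2 : Zmod N,
     (b1, b2) <> (0, 0) ->
     gcdn (gcdn (residue b1) (residue b2)) M2 = 1%N ->
     let C := code_gen (mx_of_rows 2 5
       [:: [:: M; 0; M; b1; - b1];
           [:: M; M; 0; b2; - b2]]) in
     is_direct_sum C \/ code_iso C (code_gen g)) /\
  simplex_hstar R (code_gen g)
    (((3 * N %/ 2)%N%:R - 1) *: 'X^2 + (N %/ 2)%N%:R *: 'X + 1).
Proof.
have N0 : (0 < N)%N by exact: ltnW.
move=> M2 M g; split; last exact: (simplex_hstar_gen N0 hNeven R).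
move=> b1 b2 _ b_gcd C; case: (boolP (odd (residue b1) || odd (residue b2))) => [bodd|].
  right; have [p [q pq]] := residue_bezout N0 hNeven b1 b2 bodd b_gcd.
  exact: (odd_code_iso N0 hNeven b1 b2 p q bodd pq).
rewrite negb_or => /andP[b1e b2e]; left.
apply: even_direct_sum => //; apply: contraT; rewrite -dvdn2 => M2e.
suff : (2 %| gcdn (gcdn (residue b1) (residue b2)) M2)%N by rewrite b_gcd.
by rewrite !dvdn_gcd !dvdn2 b1e b2e -dvdn2.
Qed.
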